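(* Let $(P\colon\mathcal{E}\to\mathcal{B},J,\mathit{Triv})$ be an abelian fibred site with trivial objects. Then the subfibration $\mathit{Loc}\subset P$ of locally trivial objects is an exact subfibration of $P$.
   Context: Subfunctors. For a functor $P\colon\mathcal{E}\to\mathcal{B}$, a subfunctor $Q\subset P$ consists of subcategories $Q_t\subset\mathcal{E}$ and $Q_b\subset\mathcal{B}$ such that $P$ restricts to $Q\colon Q_t\to Q_b$. Fibres are $\mathcal{E}_B=P^{-1}(B)$. $Q$ is globally full if $Q_t\subset\mathcal{E}$, $Q_b\subset\mathcal{B}$ are full; it is replete if each fibre $Q_B$ is closed in $\mathcal{E}_B$ under isomorphisms. If $P$ is a fibration, a subfibration of $P$ is a subfunctor that is a fibration and whose inclusion preserves Cartesian arrows. A subfibration of trivial objects is a subfibration $\mathit{Triv}\colon\mathit{Triv}_t\to\mathit{Triv}_b$ of $P$ that is globally full and replete; objects of $\mathit{Triv}_t$, $\mathit{Triv}_b$ are called trivial. Coverings. A covering of an object $C$ is a set of arrows with codomain $C$; $S$ refines $R$ (coverings of the same object) if each arrow of $S$ factors through some arrow of $R$. A covering function $J$ on a category assigns to each object $C$ a class $J(C)$ of coverings of $C$. Axioms: (M) $\{1_C\}\in J(C)$ for all $C$; (C) given a $J$-covering $R$ of $C$ and $f\colon B\to C$, there is a $J$-covering $S$ of $B$ such that $\{f\circ g\mid g\in S\}$ refines $R$; (L) given a $J$-covering $R$ and for each $f\in R$ a $J$-covering $R_f$ of $\mathrm{dom}\, f$, the covering $\bigcup_{f\in R}\{f\circ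 g\mid g\in R_f\}$ is refined by a $J$-covering. Local triviality. Let $P$ be a fibration, $J$ a covering function on $\mathcal{B}$. $B\in\mathcal{B}$ is locally trivial for a covering $R$ of $B$ if all domains of arrows of $R$ are trivial; $E\in\mathcal{E}$ is locally trivial for a covering $R$ of $P(E)$ if the inverse images $f^*E$, $f\in R$, are all trivial. Locally trivial means locally trivial for some $J$-covering. $\mathit{Loc}\colon\mathit{Loc}_t\to\mathit{Loc}_b$ is the restriction of $P$ to the full subcategories of locally trivial objects. $J_l$ is the covering function on $\mathit{Loc}_b$ whose coverings are the $J$-coverings all of whose arrows have trivial domains. A fibred site with trivial objects $(P,J,\mathit{Triv})$ consists of a fibration $P$, a covering function $J$ on $\mathcal{B}$ satisfying (M), and a subfibration of trivial objects $\mathit{Triv}\subset P$, such that $J_l$ satisfies (C). In that case $\mathit{Loc}$ is a subfibration of $P$. Exactness. An exact category (Quillen) is an additive category $\mathcal{C}$ that is a full additive subcategory of some abelian category $\mathcal{D}$, closed under extensions in $\mathcal{D}$ (if $A\to B\to C$ is short exact in $\mathcal{D}$ with $A,C$ isomorphic to objects of $\mathcal{C}$, then $B$ is isomorphic to an object of $\mathcal{C}$), together with the class of all short exact sequences of $\mathcal{D}$ with objects in $\mathcal{C}$ (the admissible ones). An abelian category is exact with all its short exact sequences. An exact subcategory of an exact category is a full additive subcategory closed under extensions in it (for admissible short exact sequences), equipped with all admissible short exact sequences with objects in the subcategory. A functor between exact categories is exact if it is additive and preserves admissible short exact sequences. An abelian fibration is a fibration whose fibres are abelian and whose inverse image functors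 are additive. An exact fibration is a fibration with additive inverse image functors whose fibres are endowed with exact structures (the inverse image functors need not be exact); an abelian fibration is in particular exact. An exact subfibration of an exact fibration is a subfibration whose fibres are exact subcategories of the corresponding fibres. A covering is flat in $P$ if the inverse image functor of each of its arrows is exact. An abelian fibred site with trivial objects is a fibred site with trivial objects $(P,J,\mathit{Triv})$ such that: $P$ is an abelian fibration; $\mathit{Triv}\subset P$ is an exact subfibration; $J_l$-coverings are flat in $P$; and $J_l$ satisfies (L). *)

(* Defs.v *)
From Stdlib Require Import IndefiniteDescription ProofIrrelevance.

Set Implicit Arguments.
Unset Strict Implicit.
Unset Printing Implicit Defensive.

Declare Scope cat_scope.
Delimit Scope cat_scope with cat.
Local Open Scope cat_scope.

Record category : Type := Category {
  ob :> Type;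
  hom : ob -> ob -> Type;
  id : forall a, hom a a;
  comp : forall a b c, hom b c -> hom a b -> hom a c;
  comp_id_l : forall a b (f : hom a b), comp (id b) f = f;
  comp_id_r : forall a b (f : hom a b), comp f (id a) = f;
  comp_assoc : forall a b c d (h : hom c d) (g : hom b c) (f : hom a b),
    comp h (comp g f) = comp (comp h g) f }.

Arguments hom {c0} _ _ : rename.
Arguments id {c0} a : rename.
Arguments comp {c0 a b c} _ _ : rename.

Notation "g ∘ f" := (comp g f) (at level 40, left associativity) : cat_scope.

Record functor (C D : category) : Type := Functor {
  fob :> C -> D;
  fmap : forall a b : C, hom a b -> hom (fob a) (fob b);
  fmap_id : forall a : C, fmap (id a) = id (fob a);
  fmap_comp : forall (a b c : C) (g : hom b c) (f : hom a b),
    fmap (g ∘ f) = fmap g ∘ fmap f }.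

Arguments fmap {C D} _ {a b} _.

Definition is_iso (C : category) (a b : C) (f : hom a b) : Prop :=
  exists g : hom b a, g ∘ f = id a /\ f ∘ g = id b.

Definition isomorphic (C : category) (a b : C) : Prop :=
  exists f : hom a b, is_iso f.

Definition functor_id (C : category) : functor C C :=
  @Functor C C (fun a => a) (fun _ _ f => f)
    (fun _ => eq_refl) (fun _ _ _ _ _ => eq_refl).

Record subcategory (C : category) : Type := Subcategory {
  sub_ob :> C -> Prop;
  sub_hom : forall a b : C, hom a b -> Prop;
  sub_hom_ob : forall (a b : C) (f : hom a b),
    sub_hom f -> sub_ob a /\ sub_ob b;
  sub_id : forall a : C, sub_ob a -> sub_hom (id a);
  sub_comp : forall (a b c : C) (g : hom b c) (f : hom a b),
    sub_hom g -> sub_hom f -> sub_hom (g ∘ f) }.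

Arguments sub_hom {C} _ {a b} _.

Definition full (C : category) (S : subcategory C) : Prop :=
  forall (a b : C) (f : hom a b), S a -> S b -> sub_hom S f.

Program Definition full_subcategory (C : category) (S : C -> Prop) :
    subcategory C :=
  @Subcategory C S (fun a b _ => S a /\ S b) _ _ _.

Lemma sig_eq (T : Type) (Q : T -> Prop) (x y : {t : T | Q t}) :
  proj1_sig x = proj1_sig y -> x = y.
Proof.
destruct x as [x p], y as [y q]; simpl; intros e; subst y; f_equal.
apply proof_irrelevance.
Qed.

Program Definition sub_cat (C : category) (S : subcategory C) : category :=
  @Category {a : C | S a}
    (fun a b => {f : hom (proj1_sig a) (proj1_sig b) | sub_hom S f})
    (fun a => exist _ (id (proj1_sig a)) _)
    (fun a b c g f => exist _ (proj1_sig g ∘ proj1_sig f) _) _ _ _.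
Next Obligation. now apply sub_id. Qed.
Next Obligation. now apply sub_comp. Qed.
Next Obligation. apply sig_eq; apply comp_id_l. Qed.
Next Obligation. apply sig_eq; apply comp_id_r. Qed.
Next Obligation. apply sig_eq; apply comp_assoc. Qed.

(* The identity of [a], seen as an arrow from [a] to [b] when [a = b]; it
   replaces type casts when objects of the base are compared for equality. *)
Definition eq_hom (C : category) (a b : C) (e : a = b) : hom a b :=
  match e in _ = x return hom a x with eq_refl => id a end.

Section Fibrations.
Variables (E B : category) (P : functor E B).

Definition fibre_ob (b : B) : Type := {X : E | P X = b}.

Definition fibre_val (b : B) (X : fibre_ob b) : E := proj1_sig X.

Definition fibre_eq (b : B) (X : fibre_ob b) : P (fibre_val X) = b :=
  proj2_sig X.

(* [P f = u], up to the identifications [P X = a] and [P Y = b]. *)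
Definition over (a b : B) (u : hom a b) (X : fibre_ob a) (Y : fibre_ob b)
    (f : hom (fibre_val X) (fibre_val Y)) : Prop :=
  eq_hom (fibre_eq Y) ∘ fmap P f = u ∘ eq_hom (fibre_eq X).

Lemma over_id (b : B) (X : fibre_ob b) : over (id b) (id (fibre_val X)).
Proof. now unfold over; rewrite fmap_id, comp_id_r, comp_id_l. Qed.

Lemma over_comp (a b c : B) (v : hom b c) (u : hom a b)
    (X : fibre_ob a) (Y : fibre_ob b) (Z : fibre_ob c)
    (g : hom (fibre_val Y) (fibre_val Z))
    (f : hom (fibre_val X) (fibre_val Y)) :
  over v g -> over u f -> over (v ∘ u) (g ∘ f).
Proof.
unfold over; intros Hg Hf.
now rewrite fmap_comp, comp_assoc, Hg, <- comp_assoc, Hf, comp_assoc.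
Qed.

Lemma vertical_comp (b : B) (X Y Z : fibre_ob b)
    (g : hom (fibre_val Y) (fibre_val Z))
    (f : hom (fibre_val X) (fibre_val Y)) :
  over (id b) g -> over (id b) f -> over (id b) (g ∘ f).
Proof. intros Hg Hf; rewrite <- (comp_id_l (id b)); now apply (over_comp (Y := Y)). Qed.

Program Definition fibre (b : B) : category :=
  @Category (fibre_ob b)
    (fun X Y => {f : hom (fibre_val X) (fibre_val Y) | over (id b) f})
    (fun X => exist _ (id (fibre_val X)) (over_id X))
    (fun X Y Z g f => exist _ (proj1_sig g ∘ proj1_sig f)
       (vertical_comp (proj2_sig g) (proj2_sig f))) _ _ _.
Next Obligation. apply sig_eq; apply comp_id_l. Qed.
Next Obligation. apply sig_eq; apply comp_id_r. Qed.
Next Obligation. apply sig_eq; apply comp_assoc. Qed.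

Definition cartesian (X Y : E) (f : hom X Y) : Prop :=
  forall (Z : E) (g : hom Z Y) (w : hom (P Z) (P X)),
    fmap P f ∘ w = fmap P g ->
    exists! h : hom Z X, fmap P h = w /\ f ∘ h = g.

Record cartesian_lift (a b : B) (u : hom a b) (Y : fibre b) : Type := {
  lift_dom : fibre a;
  lift_hom : hom (fibre_val lift_dom) (fibre_val Y);
  lift_over : over u lift_hom;
  lift_cartesian : cartesian lift_hom }.

Definition fibration : Prop :=
  forall (a b : B) (u : hom a b) (Y : fibre b), inhabited (cartesian_lift u Y).

(* Inverse image functors are taken for a cleavage chosen by the axiom of
   choice; triviality of an inverse image does not depend on it when the trivial
   objects are replete. *)

Hypothesis HP : fibration.

Definition lift (a b : B) (u : hom a b) (Y : fibre b) : cartesian_lift u Y :=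
  proj1_sig (constructive_indefinite_description (fun _ => True)
    (let (l) := HP u Y in ex_intro _ l I)).

Lemma eq_hom_inv (a b : B) (e : a = b) :
  eq_hom (eq_sym e) ∘ eq_hom e = id a /\ eq_hom e ∘ eq_hom (eq_sym e) = id b.
Proof. destruct e; simpl; now rewrite comp_id_l. Qed.

Lemma eq_hom_cancel (a b c : B) (e : b = c) (f g : hom a b) :
  eq_hom e ∘ f = eq_hom e ∘ g -> f = g.
Proof. destruct e; simpl; now rewrite !comp_id_l. Qed.

Lemma lift_factor (a b : B) (u : hom a b) (X : fibre a) (Y : fibre b)
    (l : cartesian_lift u Y) (g : hom (fibre_val X) (fibre_val Y)) :
  over u g ->
  exists! h : @hom (fibre a) X (lift_dom l), lift_hom l ∘ proj1_sig h = g.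
Proof.
intros Hg; destruct l as [L k Hk Ck]; simpl.
destruct (eq_hom_inv (fibre_eq L)) as [_ EL].
assert (Hw : forall h : hom (fibre_val X) (fibre_val L), over (id a) h <->
  fmap P h = eq_hom (eq_sym (fibre_eq L)) ∘ eq_hom (fibre_eq X)).
{ intros h; unfold over; rewrite comp_id_l; split; intros H.
  - apply (eq_hom_cancel (e := fibre_eq L)).
    now rewrite comp_assoc, EL, comp_id_l.
  - now rewrite H, comp_assoc, EL, comp_id_l. }
destruct (Ck _ g (eq_hom (eq_sym (fibre_eq L)) ∘ eq_hom (fibre_eq X)))
  as [h [[h1 h2] hu]].
{ apply (eq_hom_cancel (e := fibre_eq Y)).
  rewrite comp_assoc, Hk, <- (comp_assoc u), (comp_assoc (eq_hom (fibre_eq L))).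
  now rewrite EL, comp_id_l, Hg. }
exists (exist _ h (proj2 (Hw h) h1)); split; [exact h2|].
intros [h' Hh'] E'; apply sig_eq; simpl in *.
apply hu; split; [now apply Hw | exact E'].
Qed.

Lemma inv_image_over (a b : B) (u : hom a b) (X Y : fibre b) (v : hom X Y) :
  over u (proj1_sig v ∘ lift_hom (lift u X)).
Proof.
pose proof (over_comp (proj2_sig v) (lift_over (lift u X))) as H.
now rewrite comp_id_l in H.
Qed.

Definition inv_image_sig (a b : B) (u : hom a b) (X Y : fibre b)
    (v : hom X Y) :=
  constructive_indefinite_description _
    (lift_factor (lift u Y) (inv_image_over u v)).

Definition inv_image_map (a b : B) (u : hom a b) (X Y : fibre b)
    (v : hom X Y) : hom (lift_dom (lift u X)) (lift_dom (lift u Y)) :=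
  proj1_sig (inv_image_sig u v).

Lemma inv_image_map_comm (a b : B) (u : hom a b) (X Y : fibre b)
    (v : hom X Y) :
  lift_hom (lift u Y) ∘ proj1_sig (inv_image_map u v)
  = proj1_sig v ∘ lift_hom (lift u X).
Proof. exact (proj1 (proj2_sig (inv_image_sig u v))). Qed.

Lemma inv_image_map_unique (a b : B) (u : hom a b) (X Y : fibre b)
    (v : hom X Y) (h : hom (lift_dom (lift u X)) (lift_dom (lift u Y))) :
  lift_hom (lift u Y) ∘ proj1_sig h = proj1_sig v ∘ lift_hom (lift u X) ->
  inv_image_map u v = h.
Proof. exact (proj2 (proj2_sig (inv_image_sig u v)) h). Qed.

Program Definition inv_image (a b : B) (u : hom a b) :
    functor (fibre b) (fibre a) :=
  @Functor (fibre b) (fibre a)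
    (fun X => lift_dom (lift u X)) (fun X Y v => inv_image_map u v) _ _.
Next Obligation.
apply inv_image_map_unique; simpl; now rewrite comp_id_l, comp_id_r.
Qed.
Next Obligation.
apply inv_image_map_unique; simpl.
now rewrite comp_assoc, inv_image_map_comm, <- !comp_assoc, inv_image_map_comm.
Qed.

End Fibrations.

Record subfunctor (E B : category) (P : functor E B) : Type := Subfunctor {
  sub_t : subcategory E;
  sub_b : subcategory B;
  sub_restr_ob : forall X : E, sub_t X -> sub_b (P X);
  sub_restr_hom : forall (X Y : E) (f : hom X Y),
    sub_hom sub_t f -> sub_hom sub_b (fmap P f) }.

Section Subfunctors.
Variables (E B : category) (P : functor E B) (Q : subfunctor P).

Program Definition restriction : functor (sub_cat (sub_t Q)) (sub_cat (sub_b Q)) :=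
  @Functor (sub_cat (sub_t Q)) (sub_cat (sub_b Q))
    (fun X => exist _ (P (proj1_sig X)) (sub_restr_ob (proj2_sig X)))
    (fun X Y f => exist _ (fmap P (proj1_sig f)) (sub_restr_hom (proj2_sig f)))
    _ _.
Next Obligation. apply sig_eq; apply fmap_id. Qed.
Next Obligation. apply sig_eq; apply fmap_comp. Qed.

(* The fibre of [Q] over [b], as a subcategory of the fibre of [P]. *)
Program Definition sub_fibre (b : B) : subcategory (fibre P b) :=
  @Subcategory (fibre P b)
    (fun X => sub_t Q (fibre_val X))
    (fun X Y f => sub_hom (sub_t Q) (proj1_sig f)) _ _ _.
Next Obligation. now apply (sub_hom_ob (s := sub_t Q)) in H. Qed.
Next Obligation. now apply sub_id. Qed.
Next Obligation. now apply sub_comp. Qed.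

Definition globally_full : Prop := full (sub_t Q) /\ full (sub_b Q).

Definition replete : Prop :=
  forall (b : B) (X Y : fibre P b) (f : hom X Y),
    sub_b Q b -> is_iso f -> sub_fibre b X -> sub_hom (sub_fibre b) f.

Definition subfibration : Prop :=
  fibration restriction /\
  forall (X Y : sub_cat (sub_t Q)) (f : hom X Y),
    cartesian restriction f -> cartesian P (proj1_sig f).

Definition subfibration_of_trivial_objects : Prop :=
  subfibration /\ globally_full /\ replete.

End Subfunctors.

(* The size condition that a covering be a set of arrows is not imposed. *)

Record arrow_to (C : category) (c : C) : Type := ArrowTo {
  dom : C;
  arr : hom dom c }.

Arguments ArrowTo {C c dom} arr.

Definition covering (C : category) (c : C) : Type := arrow_to c -> Prop.

Definition covering_function (C : category) : Type :=
  forall c : C, covering c -> Prop.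

Section Coverings.
Variable C : category.

Definition refines (c : C) (S R : covering c) : Prop :=
  forall f, S f -> exists2 g, R g & exists h : hom (dom f) (dom g),
    arr f = arr g ∘ h.

Definition identity_covering (c : C) : covering c := fun f => f = ArrowTo (id c).

Definition post_compose (b c : C) (f : hom b c) (S : covering b) : covering c :=
  fun k => exists2 g, S g & k = ArrowTo (f ∘ arr g).

Definition composite_covering (c : C) (R : covering c)
    (S : forall f : arrow_to c, covering (dom f)) : covering c :=
  fun k => exists2 f, R f & post_compose (arr f) (S f) k.

Variable J : covering_function C.
Arguments J : clear implicits.

Definition axiom_M : Prop := forall c : C, J c (@identity_covering c).

Definition axiom_C : Prop :=
  forall (c : C) (R : covering c), J c R ->
  forall (b : C) (f : hom b c),
  exists2 S : covering b, J b S & refines (post_compose f S) R.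

Definition axiom_L : Prop :=
  forall (c : C) (R : covering c), J c R ->
  forall S : (forall f : arrow_to c, covering (dom f)),
  (forall f, R f -> J (dom f) (S f)) ->
  exists2 T : covering c, J c T & refines T (composite_covering R S).

End Coverings.

Definition sub_covering (C : category) (S : subcategory C) (c : sub_cat S)
    (R : covering c) : covering (proj1_sig c) :=
  fun f => exists2 g : arrow_to c, R g & f = ArrowTo (proj1_sig (arr g)).

Section LocallyTrivial.
Variables (E B : category) (P : functor E B) (HP : fibration P).
Variables (J : covering_function B) (Triv : subfunctor P).
Arguments J : clear implicits.

Definition locally_trivial_base_for (b : B) (R : covering b) : Prop :=
  forall f, R f -> sub_b Triv (dom f).

Definition locally_trivial_base (b : B) : Prop :=
  exists2 R : covering b, J b R & locally_trivial_base_for R.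

Definition locally_trivial_total_for (X : E) (R : covering (P X)) : Prop :=
  forall f, R f ->
    sub_t Triv (fibre_val (inv_image HP (arr f) (exist _ X eq_refl))).

Definition locally_trivial_total (X : E) : Prop :=
  exists2 R : covering (P X), J (P X) R & locally_trivial_total_for R.

Lemma locally_trivial_proj (X : E) :
  locally_trivial_total X -> locally_trivial_base (P X).
Proof.
intros [R JR HR]; exists R; [exact JR|].
intros f Rf; specialize (HR f Rf); apply sub_restr_ob in HR.
unfold fibre_val in HR.
now rewrite (proj2_sig (inv_image HP (arr f) (exist _ X eq_refl))) in HR.
Qed.

Definition Loc_b : subcategory B := full_subcategory locally_trivial_base.

Definition Loc_t : subcategory E := full_subcategory locally_trivial_total.

Program Definition Loc : subfunctor P := @Subfunctor E B P Loc_t Loc_b _ _.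
Next Obligation. now apply locally_trivial_proj. Qed.
Next Obligation. now split; apply locally_trivial_proj. Qed.

Definition J_l : covering_function (sub_cat Loc_b) :=
  fun b R => J (proj1_sig b) (sub_covering R) /\ locally_trivial_base_for (sub_covering R).

Record fibred_site_with_trivial_objects : Prop := {
  site_fibration : fibration P;
  site_M : axiom_M J;
  site_trivial : subfibration_of_trivial_objects Triv;
  site_local_C : axiom_C J_l }.

End LocallyTrivial.

Arguments J_l {E B P} J Triv c R.

Record preadditive (C : category) : Type := Preadditive {
  hadd : forall a b : C, hom a b -> hom a b -> hom a b;
  hzero : forall a b : C, hom a b;
  hopp : forall a b : C, hom a b -> hom a b;
  haddA : forall (a b : C) (f g h : hom a b),
    hadd f (hadd g h) = hadd (hadd f g) h;
  haddC : forall (a b : C) (f g : hom a b), hadd f g = hadd g f;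
  hadd0 : forall (a b : C) (f : hom a b), hadd (hzero a b) f = f;
  haddN : forall (a b : C) (f : hom a b), hadd (hopp f) f = hzero a b;
  hcompDl : forall (a b c : C) (g g' : hom b c) (f : hom a b),
    hadd g g' ∘ f = hadd (g ∘ f) (g' ∘ f);
  hcompDr : forall (a b c : C) (g : hom b c) (f f' : hom a b),
    g ∘ hadd f f' = hadd (g ∘ f) (g ∘ f') }.

Arguments hadd {C} _ {a b} _ _.
Arguments hzero {C} _ a b.

Section Additive.
Variables (C : category) (A : preadditive C).

Definition zero_object (z : C) : Prop :=
  forall a : C, (exists! f : hom a z, True) /\ (exists! f : hom z a, True).

Definition biproduct (a b s : C) : Prop :=
  exists (i1 : hom a s) (i2 : hom b s) (p1 : hom s a) (p2 : hom s b),
    p1 ∘ i1 = id a /\ p2 ∘ i2 = id b /\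
    p1 ∘ i2 = hzero A b a /\ p2 ∘ i1 = hzero A a b /\
    hadd A (i1 ∘ p1) (i2 ∘ p2) = id s.

Definition additive : Prop :=
  (exists z : C, zero_object z) /\
  (forall a b : C, exists s : C, biproduct a b s).

Definition is_kernel (k a b : C) (i : hom k a) (f : hom a b) : Prop :=
  f ∘ i = hzero A k b /\
  forall (x : C) (g : hom x a), f ∘ g = hzero A x b ->
    exists! h : hom x k, i ∘ h = g.

Definition is_cokernel (a b q : C) (f : hom a b) (p : hom b q) : Prop :=
  p ∘ f = hzero A a q /\
  forall (x : C) (g : hom b x), g ∘ f = hzero A a x ->
    exists! h : hom q x, h ∘ p = g.

Definition mono (a b : C) (f : hom a b) : Prop :=
  forall (x : C) (g h : hom x a), f ∘ g = f ∘ h -> g = h.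

Definition epi (a b : C) (f : hom a b) : Prop :=
  forall (x : C) (g h : hom b x), g ∘ f = h ∘ f -> g = h.

Record abelian : Prop := {
  ab_additive : additive;
  ab_kernel : forall (a b : C) (f : hom a b),
    exists (k : C) (i : hom k a), is_kernel i f;
  ab_cokernel : forall (a b : C) (f : hom a b),
    exists (q : C) (p : hom b q), is_cokernel f p;
  ab_mono : forall (a b : C) (f : hom a b), mono f ->
    exists (c : C) (g : hom b c), is_kernel f g;
  ab_epi : forall (a b : C) (f : hom a b), epi f ->
    exists (c : C) (g : hom c a), is_cokernel g f }.

Definition short_exact (a b c : C) (i : hom a b) (p : hom b c) : Prop :=
  is_kernel i p /\ is_cokernel i p.

End Additive.

Definition additive_functor (C D : category) (A : preadditive C)
    (A' : preadditive D) (F : functor C D) : Prop :=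
  forall (a b : C) (f g : hom a b),
    fmap F (hadd A f g) = hadd A' (fmap F f) (fmap F g).

Definition short_sequences (C : category) : Type :=
  forall a b c : C, hom a b -> hom b c -> Prop.

Definition closed_under_extensions (C : category) (adm : short_sequences C)
    (S : C -> Prop) : Prop :=
  forall (a b c : C) (i : hom a b) (p : hom b c), adm a b c i p ->
    (exists2 a', S a' & isomorphic a a') ->
    (exists2 c', S c' & isomorphic c c') ->
    exists2 b', S b' & isomorphic b b'.

Record full_embedding (C D : category) (F : functor C D) : Prop := {
  emb_ob : forall a b : C, F a = F b -> a = b;
  emb_hom : forall (a b : C) (g : hom (F a) (F b)),
    exists! f : hom a b, fmap F f = g }.

Record exact_category (C : category) : Type := ExactCategory {
  exact_preadditive : preadditive C;
  admissible : short_sequences C;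
  exact_additive : additive exact_preadditive;
  exact_ambient : exists (D : category) (A : preadditive D) (F : functor C D),
    abelian A /\ full_embedding F /\
    additive_functor exact_preadditive A F /\
    closed_under_extensions (@short_exact D A) (fun d => exists c, d = F c) /\
    forall (a b c : C) (i : hom a b) (p : hom b c),
      admissible i p <-> short_exact A (fmap F i) (fmap F p) }.

Arguments admissible {C} _ {a b c} _ _.

Definition exact_functor (C D : category) (X : exact_category C)
    (Y : exact_category D) (F : functor C D) : Prop :=
  additive_functor (exact_preadditive X) (exact_preadditive Y) F /\
  forall (a b c : C) (i : hom a b) (p : hom b c),
    admissible X i p -> admissible Y (fmap F i) (fmap F p).

Program Definition exact_of_abelian (C : category) (A : preadditive C)
    (HA : abelian A) : exact_category C :=
  @ExactCategory C A (@short_exact C A) (ab_additive HA) _.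
Next Obligation.
exists C, A, (functor_id C).
split; [exact HA|]; split; [split|split; [|split]].
- intros a b e; exact e.
- intros a b g; exists g; split; [reflexivity | intros f e; now symmetry].
- intros a b f g; reflexivity.
- intros a b c _ _ _ _ _; exists b; [now exists b|].
  exists (id b), (id b); split; apply comp_id_l.
- intros a b c i p; simpl; tauto.
Qed.

(* Zero objects and biproducts of the additive category [C] lying in the full
   subcategory [S] are those of [S]. *)
Definition additive_subcategory (C : category) (A : preadditive C)
    (S : subcategory C) : Prop :=
  (exists2 z : C, S z & zero_object z) /\
  (forall a b : C, S a -> S b -> exists2 s : C, S s & biproduct A a b s).

Record exact_subcategory (C : category) (X : exact_category C)
    (S : subcategory C) : Prop := {
  exact_sub_full : full S;
  exact_sub_additive : additive_subcategory (exact_preadditive X) S;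
  exact_sub_extensions : closed_under_extensions (@admissible C X) S }.

Record exact_fibration (E B : category) (P : functor E B) : Type := {
  exact_fib : fibration P;
  exact_fibre : forall b : B, exact_category (fibre P b);
  exact_inv_image : forall (a b : B) (u : hom a b),
    additive_functor (exact_preadditive (exact_fibre b))
      (exact_preadditive (exact_fibre a)) (inv_image exact_fib u) }.

Record abelian_fibration (E B : category) (P : functor E B) : Type := {
  abelian_fib : fibration P;
  abelian_preadditive : forall b : B, preadditive (fibre P b);
  abelian_fibre : forall b : B, abelian (abelian_preadditive b);
  abelian_inv_image : forall (a b : B) (u : hom a b),
    additive_functor (abelian_preadditive b) (abelian_preadditive a)
      (inv_image abelian_fib u) }.

Definition exact_of_abelian_fibration (E B : category) (P : functor E B)
    (A : abelian_fibration P) : exact_fibration P :=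
  @Build_exact_fibration E B P (abelian_fib A)
    (fun b => exact_of_abelian (abelian_fibre A b)) (@abelian_inv_image E B P A).

Coercion exact_of_abelian_fibration : abelian_fibration >-> exact_fibration.

Definition exact_subfibration (E B : category) (P : functor E B)
    (X : exact_fibration P) (Q : subfunctor P) : Prop :=
  subfibration Q /\
  forall b : B, sub_b Q b -> exact_subcategory (exact_fibre X b) (sub_fibre Q b).

Definition flat (E B : category) (P : functor E B) (X : exact_fibration P)
    (b : B) (R : covering b) : Prop :=
  forall f, R f -> exact_functor (exact_fibre X b) (exact_fibre X (dom f))
    (inv_image (exact_fib X) (arr f)).

Record abelian_fibred_site (E B : category) (P : functor E B)
    (A : abelian_fibration P) (J : covering_function B)
    (Triv : subfunctor P) : Prop := {
  ab_site : fibred_site_with_trivial_objects J Triv;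
  ab_site_exact : exact_subfibration A Triv;
  ab_site_flat : forall (b : sub_cat (Loc_b J Triv)) (R : covering b),
    J_l J Triv b R -> flat A (sub_covering R);
  ab_site_L : axiom_L (J_l J Triv) }.

(* Main.v *)
(* Local triviality is inherited along refinements by coverings with trivial
   domains: if [f^*X] is trivial and [u ∘ g = f ∘ h] with [dom g] trivial, then
   [g^*(u^*X)] is isomorphic to [h^*(f^*X)], which is trivial because Triv is a
   full replete subfibration.  With (C) this shows that Loc is stable under
   inverse images, and with (C) and (L) that two locally trivial objects over
   the same base object are locally trivial for a common [J_l]-covering.  The
   inverse images along its arrows are additive and exact, so zero objects,
   biproducts and extensions are locally sent to those of Triv. *)

From Stdlib Require Import IndefiniteDescription ProofIrrelevance
  FunctionalExtensionality PropExtensionality.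
Require Import Defs.

Set Implicit Arguments.
Unset Strict Implicit.
Unset Printing Implicit Defensive.
Local Open Scope cat_scope.

Lemma isomorphic_sym (C : category) (a b : C) :
  isomorphic a b -> isomorphic b a.
Proof. intros [f [g [gf fg]]]; exists g, f; auto. Qed.

Lemma fmap_isomorphic (C D : category) (F : functor C D) (a b : C) :
  isomorphic a b -> isomorphic (F a) (F b).
Proof.
intros [f [g [gf fg]]]; exists (fmap F f), (fmap F g).
now rewrite <- !fmap_comp, gf, fg, !fmap_id.
Qed.

(** * Composition and uniqueness of Cartesian lifts *)

Section CartesianLifts.
Variables (E B : category) (P : functor E B).

Lemma cartesian_comp (X Y Z : E) (g : hom Y Z) (f : hom X Y) :
  cartesian P g -> cartesian P f -> cartesian P (g ∘ f).
Proof.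
intros Cg Cf W k w Hw.
destruct (Cg W k (fmap P f ∘ w)) as [h [[Ph gh] hu]].
{ now rewrite comp_assoc, <- fmap_comp. }
destruct (Cf W h w (eq_sym Ph)) as [m [[Pm fm] mu]].
exists m; split.
- split; [exact Pm|]; now rewrite <- comp_assoc, fm.
- intros m' [Pm' Em']; apply mu; split; [exact Pm'|].
  symmetry; apply hu; split.
  + now rewrite fmap_comp, Pm'.
  + now rewrite comp_assoc.
Qed.

Lemma cartesian_iso (X Y : E) (f : hom X Y) : is_iso f -> cartesian P f.
Proof.
intros [g [gf fg]] Z k w Hw; exists (g ∘ k); split; [split|].
- now rewrite fmap_comp, <- Hw, comp_assoc, <- fmap_comp, gf, fmap_id, comp_id_l.
- now rewrite comp_assoc, fg, comp_id_l.
- intros h [_ <-]; now rewrite comp_assoc, gf, comp_id_l.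
Qed.

Definition cartesian_lift_comp (a b c : B) (v : hom b c) (u : hom a b)
    (Y : fibre P c) (l : cartesian_lift v Y)
    (m : cartesian_lift u (lift_dom l)) : cartesian_lift (v ∘ u) Y :=
  Build_cartesian_lift (over_comp (lift_over l) (lift_over m))
    (cartesian_comp (@lift_cartesian _ _ _ _ _ _ _ l)
       (@lift_cartesian _ _ _ _ _ _ _ m)).

(** Each lift factors through the other, and both composites factor a lift through itself, so
    uniqueness makes them identities. This allows any lift to be traded for the one chosen by the
    cleavage. *)
Lemma cartesian_lift_iso (a b : B) (u : hom a b) (Y : fibre P b)
    (l m : cartesian_lift u Y) :
  exists2 h : @hom (fibre P a) (lift_dom l) (lift_dom m),
    is_iso h & lift_hom m ∘ proj1_sig h = lift_hom l.
Proof.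
destruct (lift_factor m (lift_over l)) as [h [Eh _]].
destruct (lift_factor l (lift_over m)) as [k [Ek _]].
exists h; [exists k; split | exact Eh].
- destruct (lift_factor l (lift_over l)) as [x [_ xu]].
  transitivity x; [symmetry|]; apply xu; simpl.
  + now rewrite comp_assoc, Ek.
  + apply comp_id_r.
- destruct (lift_factor m (lift_over m)) as [x [_ xu]].
  transitivity x; [symmetry|]; apply xu; simpl.
  + now rewrite comp_assoc, Eh.
  + apply comp_id_r.
Qed.

End CartesianLifts.

(** Serves to pass between [over] for the restriction to a subfunctor and [over] for [P]. *)
Lemma proj1_sig_eq_hom (C : category) (S : subcategory C) (a b : sub_cat S)
    (e : a = b) (e' : proj1_sig a = proj1_sig b) :
  proj1_sig (eq_hom e) = eq_hom e'.
Proof. destruct e; now rewrite (proof_irrelevance _ e' eq_refl). Qed.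

Lemma replete_isomorphic (E B : category) (P : functor E B)
    (Q : subfunctor P) (b : B) (X Y : fibre P b) :
  replete Q -> sub_b Q b -> isomorphic X Y ->
  sub_t Q (fibre_val X) -> sub_t Q (fibre_val Y).
Proof.
intros RQ Qb [f If] QX.
exact (proj2 (sub_hom_ob (RQ _ _ _ f Qb If QX))).
Qed.

(** * Cartesian lifts in globally full subfunctors *)

Section GloballyFullSubfunctors.
Variables (E B : category) (P : functor E B) (Q : subfunctor P).
Hypothesis fullQ : globally_full Q.

(** The restriction has its own lift of [u] to [Y]. It stays Cartesian in [P], so its domain is
    isomorphic to that of [l], and repleteness concludes. *)
Lemma subfibration_lift_dom (SQ : subfibration Q) (RQ : replete Q)
    (a b : B) (u : hom a b) (Y : fibre P b) (l : cartesian_lift u Y) :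
  sub_b Q a -> sub_t Q (fibre_val Y) -> sub_t Q (fibre_val (lift_dom l)).
Proof.
intros Qa QY; destruct Y as [Y e]; destruct e; simpl in QY.
pose (a' := exist _ a Qa : sub_cat (sub_b Q)).
pose (Y' := exist _ Y QY : sub_cat (sub_t Q)).
pose (u' := exist _ u (proj2 fullQ _ _ u Qa (sub_restr_ob QY))
  : hom a' (restriction Q Y')).
destruct (proj1 SQ _ _ u' (exist _ Y' eq_refl)) as [[[[X QX] e] k Hk Ck]].
apply (proj2 SQ) in Ck.
pose (X' := exist _ X (f_equal (@proj1_sig _ _) e) : fibre P a).
assert (Ok : @over _ _ P _ _ u X' (exist _ Y eq_refl) (proj1_sig k)).
{ refine (eq_trans (f_equal (@proj1_sig _ _) Hk) _).
  exact (f_equal (comp u)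
    (proj1_sig_eq_hom e (f_equal (@proj1_sig _ _) e))). }
destruct (cartesian_lift_iso (Build_cartesian_lift Ok Ck) l) as [h Ih _].
refine (replete_isomorphic RQ Qa (ex_intro _ h Ih) _); exact QX.
Qed.

(** The factorisation exists in [E], and fullness of [sub_t Q] puts it in the subcategory. *)
Lemma restriction_cartesian (X Y : sub_cat (sub_t Q)) (f : hom X Y) :
  cartesian P (proj1_sig f) -> cartesian (restriction Q) f.
Proof.
intros Cf Z g w Hw.
destruct (Cf _ (proj1_sig g) (proj1_sig w)) as [h [[Ph fh] hu]].
{ exact (f_equal (@proj1_sig _ _) Hw). }
exists (exist _ h (proj1 fullQ _ _ h (proj2_sig Z) (proj2_sig X))).
split; [split; now apply sig_eq|].
intros h' [Ph' Eh']; apply sig_eq, hu; split.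
- exact (f_equal (@proj1_sig _ _) Ph').
- exact (f_equal (@proj1_sig _ _) Eh').
Qed.

Hypothesis stableQ : forall (a b : B) (u : hom a b) (Y : fibre P b)
  (l : cartesian_lift u Y),
  sub_b Q a -> sub_t Q (fibre_val Y) -> sub_t Q (fibre_val (lift_dom l)).

(** A lift taken in [P] has its domain in [Q] by stability and is an arrow of [Q] by fullness. That
    it is Cartesian in [P] is recorded for the comparison with other Cartesian arrows of the
    restriction. *)
Lemma restriction_lift (HP : fibration P) (a b : sub_cat (sub_b Q))
    (u : hom a b) (Y : fibre (restriction Q) b) :
  exists l : cartesian_lift u Y, cartesian P (proj1_sig (lift_hom l)).
Proof.
destruct Y as [[Y QY] e]; destruct e.
destruct (HP _ _ (proj1_sig u) (exist _ Y eq_refl)) as [l].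
pose proof (stableQ l (proj2_sig a) QY) as QL.
destruct l as [[L e] k Ok Ck].
pose (L' := exist _ L QL : sub_cat (sub_t Q)).
pose (Y' := exist _ Y QY : sub_cat (sub_t Q)).
pose (k' := exist _ k (proj1 fullQ _ _ k QL QY) : hom L' Y').
assert (eL : restriction Q L' = a) by now apply sig_eq.
unshelve eexists (@Build_cartesian_lift _ _ (restriction Q) _ _ u
  (exist _ Y' eq_refl) (exist _ L' eL) k' _ _); [| |exact Ck].
- apply sig_eq; refine (eq_trans Ok (eq_sym _)).
  exact (f_equal (comp (proj1_sig u)) (proj1_sig_eq_hom eL e)).
- apply restriction_cartesian; exact Ck.
Qed.

Lemma subfibration_of_stable (HP : fibration P) : subfibration Q.
Proof.
split.
- intros a b u Y; destruct (restriction_lift HP u Y) as [l _]; now constructor.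
- intros X Y f Cf.
  (* The arrow [f] is compared with a lift [m] of its own image that is known to be Cartesian in
     [P]; the two differ by an isomorphism. *)
  destruct (restriction_lift HP (fmap (restriction Q) f) (exist _ Y eq_refl))
    as [m Cm].
  assert (Of : @over _ _ (restriction Q) _ _ (fmap (restriction Q) f)
    (exist _ X eq_refl) (exist _ Y eq_refl) f).
  { unfold over; simpl fibre_eq; cbn [eq_hom].
    exact (eq_trans (comp_id_l _) (eq_sym (comp_id_r _))). }
  destruct (cartesian_lift_iso (Build_cartesian_lift Of Cf) m)
    as [h [k [kh hk]] Eh].
  simpl in Eh; rewrite <- Eh; apply cartesian_comp; [exact Cm|].
  (* The inner projection leaves the fibre and the outer one the subcategory, so the inverse [k]
     becomes an inverse in [E]. *)
  apply cartesian_iso; exists (proj1_sig (proj1_sig k)); split.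
  + exact (f_equal (fun x => proj1_sig (proj1_sig x)) kh).
  + exact (f_equal (fun x => proj1_sig (proj1_sig x)) hk).
Qed.

End GloballyFullSubfunctors.

(** * Zero objects and biproducts, and their images under additive functors *)

Section Preadditive.
Variables (C : category) (A : preadditive C).

Lemma hadd_idem (a b : C) (f : hom a b) : hadd A f f = f -> f = hzero A a b.
Proof.
intros H; rewrite <- (hadd0 A f), <- (haddN A f) at 1.
now rewrite <- haddA, H, haddN.
Qed.

Lemma hadd0r (a b : C) (f : hom a b) : hadd A f (hzero A a b) = f.
Proof. now rewrite haddC, hadd0. Qed.

Lemma comp_zero_r (a b c : C) (g : hom b c) :
  g ∘ hzero A a b = hzero A a c.
Proof. apply hadd_idem; now rewrite <- hcompDr, hadd0. Qed.

Lemma comp_zero_l (a b c : C) (f : hom a b) :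
  hzero A b c ∘ f = hzero A a c.
Proof. apply hadd_idem; now rewrite <- hcompDl, hadd0. Qed.

(** Turns the universal property into an equation, which additive functors preserve. *)
Lemma zero_object_id (z : C) : zero_object z <-> id z = hzero A z z.
Proof.
split; intros H.
- destruct (proj1 (H z)) as [x [_ xu]]; now rewrite <- (xu (id z) I), <- xu.
- intros a; split.
  + exists (hzero A a z); split; [exact I|]; intros f _.
    now rewrite <- (comp_id_l f), H, comp_zero_l.
  + exists (hzero A z a); split; [exact I|]; intros f _.
    now rewrite <- (comp_id_r f), H, comp_zero_r.
Qed.

Lemma zero_object_isomorphic (z z' : C) :
  zero_object z -> zero_object z' -> isomorphic z z'.
Proof.
intros Hz Hz'; exists (hzero A z z'), (hzero A z' z).
apply zero_object_id in Hz, Hz'; now rewrite !comp_zero_r, Hz, Hz'.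
Qed.

(** Matching summands gives maps both ways; in the composites the cross terms vanish and the
    diagonal terms add up to the identity. *)
Lemma biproduct_isomorphic (a b s s' : C) :
  biproduct A a b s -> biproduct A a b s' -> isomorphic s s'.
Proof.
intros (i1 & i2 & p1 & p2 & e1 & e2 & e3 & e4 & e5).
intros (j1 & j2 & q1 & q2 & d1 & d2 & d3 & d4 & d5).
exists (hadd A (j1 ∘ p1) (j2 ∘ p2)), (hadd A (i1 ∘ q1) (i2 ∘ q2)); split.
- rewrite <- e5, !hcompDl, !hcompDr, <- !comp_assoc.
  rewrite !(comp_assoc q1), !(comp_assoc q2), d1, d2, d3, d4.
  now rewrite !comp_id_l, !comp_zero_l, !comp_zero_r, hadd0, hadd0r.
- rewrite <- d5, !hcompDl, !hcompDr, <- !comp_assoc.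
  rewrite !(comp_assoc p1), !(comp_assoc p2), e1, e2, e3, e4.
  now rewrite !comp_id_l, !comp_zero_l, !comp_zero_r, hadd0, hadd0r.
Qed.

End Preadditive.

Section AdditiveFunctors.
Variables (C D : category) (A : preadditive C) (A' : preadditive D).
Variables (F : functor C D) (HF : additive_functor A A' F).

Lemma additive_functor_zero (a b : C) :
  fmap F (hzero A a b) = hzero A' (F a) (F b).
Proof. apply hadd_idem; now rewrite <- HF, hadd0. Qed.

Lemma additive_functor_zero_object (z : C) :
  zero_object z -> zero_object (F z).
Proof.
intros Hz; apply (zero_object_id A) in Hz; apply (zero_object_id A').
now rewrite <- fmap_id, Hz, additive_functor_zero.
Qed.

Lemma additive_functor_biproduct (a b s : C) :
  biproduct A a b s -> biproduct A' (F a) (F b) (F s).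
Proof.
intros (i1 & i2 & p1 & p2 & e1 & e2 & e3 & e4 & e5).
exists (fmap F i1), (fmap F i2), (fmap F p1), (fmap F p2).
rewrite <- !fmap_comp, <- HF, e1, e2, e3, e4, e5.
now rewrite !fmap_id, !additive_functor_zero.
Qed.

End AdditiveFunctors.

(** By (C), [R2] is pulled back along each arrow of [R1]; by (L), some covering refines the
    composite of these pullbacks with [R1], hence both [R1] and [R2]. *)
Lemma common_refinement (C : category) (J : covering_function C) (c : C)
    (R1 R2 : covering c) :
  axiom_C J -> axiom_L J -> J c R1 -> J c R2 ->
  exists T : covering c, J c T /\ refines T R1 /\ refines T R2.
Proof.
intros HC HL J1 J2.
assert (HS : forall f : arrow_to c, exists S : covering (dom f),
  J (dom f) S /\ refines (post_compose (arr f) S) R2).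
{ intros f; destruct (HC c R2 J2 _ (arr f)) as [S JS HS]; now exists S. }
pose (S f := proj1_sig (constructive_indefinite_description _ (HS f))).
assert (PS : forall f, J (dom f) (S f) /\
  refines (post_compose (arr f) (S f)) R2).
{ intros f; exact (proj2_sig (constructive_indefinite_description _ (HS f))). }
destruct (HL c R1 J1 S (fun f _ => proj1 (PS f))) as [T JT HT].
exists T; split; [exact JT | split]; intros t Tt;
  destruct (HT t Tt) as [k [f R1f Kk] [h Eh]].
- exists f; [exact R1f|]; destruct Kk as [g Sg ->]; simpl in h, Eh.
  exists (arr g ∘ h); now rewrite comp_assoc.
- destruct (proj2 (PS f) k Kk) as [g R2g [h' Eh']].
  exists g; [exact R2g|]; exists (h' ∘ h).
  now rewrite comp_assoc, <- Eh'.
Qed.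

(** * Local triviality in the fibres and trivialising coverings *)

Section LocallyTrivialObjects.
Variables (E B : category) (P : functor E B) (HP : fibration P).
Variables (J : covering_function B) (Triv : subfunctor P).
Arguments J : clear implicits.
Hypothesis trivT : subfibration_of_trivial_objects Triv.

(** Variant of [locally_trivial_total_for] for coverings of any [b] equal to the image of the
    object, so that objects of one fibre share coverings without casts. *)
Definition fibre_trivial_for (b : B) (X : fibre P b) (R : covering b) : Prop :=
  forall f, R f -> sub_t Triv (fibre_val (inv_image HP (arr f) X)).

Lemma locally_trivial_totalE (b : B) (X : fibre P b) :
  locally_trivial_total HP J Triv (fibre_val X) <->
  exists2 R, J b R & fibre_trivial_for X R.
Proof. destruct X as [X e]; destruct e; reflexivity. Qed.

Lemma fibre_trivial_for_dom (b : B) (X : fibre P b) (R : covering b) :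
  fibre_trivial_for X R -> locally_trivial_base_for Triv R.
Proof.
intros H f Rf; rewrite <- (fibre_eq (inv_image HP (arr f) X)).
apply sub_restr_ob; exact (H f Rf).
Qed.

(** The chosen lifts along [f] and [h] compose to a lift along [v], hence one isomorphic to [l].
    Leaving [l] arbitrary lets composite lifts be used for it. *)
Lemma lift_trivial_of_factor (a b d : B) (X : fibre P b) (f : hom d b)
    (h : hom a d) (v : hom a b) (l : cartesian_lift v X) :
  v = f ∘ h -> sub_b Triv a ->
  sub_t Triv (fibre_val (inv_image HP f X)) ->
  sub_t Triv (fibre_val (lift_dom l)).
Proof.
intros -> Ta TX; destruct trivT as [SF [GF RF]].
pose (m := lift HP h (inv_image HP f X)).
pose proof (subfibration_lift_dom GF SF RF m Ta TX) as Tm.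
destruct (cartesian_lift_iso (cartesian_lift_comp m) l) as [k Ik _].
refine (replete_isomorphic RF Ta (ex_intro _ k Ik) _); exact Tm.
Qed.

Lemma fibre_trivial_for_isomorphic (b : B) (X Y : fibre P b) (R : covering b) :
  isomorphic X Y -> fibre_trivial_for X R -> fibre_trivial_for Y R.
Proof.
intros I H f Rf; destruct trivT as [_ [_ RF]].
refine (replete_isomorphic RF (fibre_trivial_for_dom H Rf) _ (H f Rf)).
now apply fmap_isomorphic.
Qed.

Lemma locally_trivial_total_isomorphic (b : B) (X Y : fibre P b) :
  isomorphic X Y -> locally_trivial_total HP J Triv (fibre_val X) ->
  locally_trivial_total HP J Triv (fibre_val Y).
Proof.
rewrite !locally_trivial_totalE; intros I [R JR HR]; exists R; [exact JR|].
now apply fibre_trivial_for_isomorphic with X.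
Qed.

Lemma fibre_trivial_for_refines (b : sub_cat (Loc_b J Triv))
    (X : fibre P (proj1_sig b)) (R T : covering b) :
  J_l J Triv b T -> refines T R ->
  fibre_trivial_for X (sub_covering R) -> fibre_trivial_for X (sub_covering T).
Proof.
intros [_ dT] TR HR f Tf; pose proof (dT f Tf) as Tdf.
destruct Tf as [t Tt ->]; destruct (TR t Tt) as [g Rg [h Eh]].
refine (lift_trivial_of_factor _ (f_equal (@proj1_sig _ _) Eh) Tdf _).
apply (HR (ArrowTo (proj1_sig (arr g)))); now exists g.
Qed.

Hypothesis HM : axiom_M J.

Lemma trivial_locally_trivial_base (b : B) :
  sub_b Triv b -> locally_trivial_base J Triv b.
Proof. intros Tb; exists (@identity_covering B b); [apply HM | now intros f ->]. Qed.

(** By (M) trivial objects are locally trivial, so every arrow of [R] already lies in the full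
    subcategory [Loc_b]. *)
Lemma J_l_of_J (b : sub_cat (Loc_b J Triv)) (R : covering (proj1_sig b)) :
  J (proj1_sig b) R -> locally_trivial_base_for Triv R ->
  exists2 S : covering b, J_l J Triv b S & sub_covering S = R.
Proof.
intros JR TR.
pose (S := (fun g => R (ArrowTo (proj1_sig (arr g)))) : covering b).
assert (ES : sub_covering S = R).
{ apply functional_extensionality; intros f.
  apply propositional_extensionality; split; [now intros [g Sg ->]|].
  intros Rf; pose proof (trivial_locally_trivial_base (TR f Rf)) as Ld.
  destruct f as [d f].
  exists (@ArrowTo (sub_cat (Loc_b J Triv)) b (exist _ d Ld)
    (exist _ f (conj Ld (proj2_sig b)))); [exact Rf | reflexivity]. }
exists S; [split; now rewrite ES | exact ES].
Qed.

(** A covering with trivial inverse images of [X] automatically has trivial domains, since [Triv]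
    restricts [P]. *)
Lemma locally_trivial_J_l (b : sub_cat (Loc_b J Triv))
    (X : fibre P (proj1_sig b)) :
  locally_trivial_total HP J Triv (fibre_val X) ->
  exists2 R : covering b, J_l J Triv b R & fibre_trivial_for X (sub_covering R).
Proof.
rewrite locally_trivial_totalE; intros [R JR HR].
destruct (J_l_of_J JR (fibre_trivial_for_dom HR)) as [S JS ES].
exists S; [exact JS | now rewrite ES].
Qed.

Lemma locally_trivial_of_J_l (b : sub_cat (Loc_b J Triv))
    (X : fibre P (proj1_sig b)) (R : covering b) :
  J_l J Triv b R -> fibre_trivial_for X (sub_covering R) ->
  locally_trivial_total HP J Triv (fibre_val X).
Proof.
intros [JR _] HR; apply locally_trivial_totalE; now exists (sub_covering R).
Qed.

Lemma Loc_globally_full : globally_full (Loc HP J Triv).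
Proof. now split. Qed.

Hypothesis HC : axiom_C (J_l J Triv).

Lemma Loc_stable (a b : B) (u : hom a b) (Y : fibre P b)
    (l : cartesian_lift u Y) :
  locally_trivial_base J Triv a -> locally_trivial_total HP J Triv (fibre_val Y) ->
  locally_trivial_total HP J Triv (fibre_val (lift_dom l)).
Proof.
intros La LY; pose proof (locally_trivial_proj LY) as Lb.
rewrite (fibre_eq Y) in Lb.
pose (a' := exist _ a La : sub_cat (Loc_b J Triv)).
pose (b' := exist _ b Lb : sub_cat (Loc_b J Triv)).
pose (u' := exist _ u (conj La Lb) : hom a' b').
destruct (@locally_trivial_J_l b' Y LY) as [R JR HR].
destruct (HC JR u') as [S JS SR].
apply (@locally_trivial_of_J_l a' (lift_dom l) S JS).
intros f Sf; pose proof (proj2 JS f Sf) as Tdf; destruct Sf as [g Sg ->].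
destruct (SR (ArrowTo (u' ∘ arr g))) as [k Rk [h Eh]]; [now exists g|].
(* The inverse image of [lift_dom l] along [g] is also a lift of [Y] along [u ∘ g], an arrow that
   factors through [k] in [R]. *)
refine (@lift_trivial_of_factor _ _ _ Y (proj1_sig (arr k)) (proj1_sig h) _
  (cartesian_lift_comp (lift HP (proj1_sig (arr g)) (lift_dom l)))
  (f_equal (@proj1_sig _ _) Eh) Tdf _).
apply (HR (ArrowTo (proj1_sig (arr k)))); now exists k.
Qed.

Hypothesis HL : axiom_L (J_l J Triv).

Lemma common_trivializing_covering (b : sub_cat (Loc_b J Triv))
    (X Y : fibre P (proj1_sig b)) :
  locally_trivial_total HP J Triv (fibre_val X) ->
  locally_trivial_total HP J Triv (fibre_val Y) ->
  exists T : covering b, J_l J Triv b T /\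
    fibre_trivial_for X (sub_covering T) /\
    fibre_trivial_for Y (sub_covering T).
Proof.
intros LX LY.
destruct (locally_trivial_J_l LX) as [R1 J1 H1].
destruct (locally_trivial_J_l LY) as [R2 J2 H2].
destruct (common_refinement HC HL J1 J2) as [T [JT [T1 T2]]].
exists T; split; [exact JT | split].
- now apply fibre_trivial_for_refines with R1.
- now apply fibre_trivial_for_refines with R2.
Qed.

End LocallyTrivialObjects.

(** * Exactness of the fibres of locally trivial objects *)

Theorem proposition4p10 (E B : category) (P : functor E B)
    (A : abelian_fibration P) (J : covering_function B) (Triv : subfunctor P)
    (site : abelian_fibred_site A J Triv) :
  exact_subfibration A (Loc (abelian_fib A) J Triv).
Proof.
destruct site as [[_ HM trivT HC] [_ exactT] flatT HL].
pose proof trivT as [_ [_ RT]].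
split.
- apply subfibration_of_stable; [apply Loc_globally_full| |exact (abelian_fib A)].
  intros a b u Y l; now apply Loc_stable.
- intros b Lb; pose (b' := exist _ b Lb : sub_cat (Loc_b J Triv)).
  split.
  + now intros X Y f LX LY.
  + split.
    (* Any covering that makes [b] locally trivial serves for [z]: its inverse images are zero
       objects, hence isomorphic to trivial ones. *)
    * destruct (proj1 (ab_additive (abelian_fibre A b))) as [z Hz].
      exists z; [|exact Hz].
      apply locally_trivial_totalE; destruct Lb as [R JR TR].
      exists R; [exact JR|]; intros f Rf.
      destruct (exact_sub_additive (exactT _ (TR f Rf))) as [[z' Tz' Hz'] _].
      refine (replete_isomorphic RT (TR f Rf) _ Tz').
      apply (zero_object_isomorphic (abelian_preadditive A (dom f))); [exact Hz'|].
      now apply (additive_functor_zero_object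
        (@abelian_inv_image _ _ _ A _ _ (arr f))).
    * intros X Y LX LY.
      destruct (proj2 (ab_additive (abelian_fibre A b)) X Y) as [s Hs].
      exists s; [|exact Hs].
      destruct (@common_trivializing_covering _ _ _ _ _ _ trivT HM HC HL b' X Y
        LX LY) as [T [JT [TX TY]]].
      apply (@locally_trivial_of_J_l _ _ _ _ _ _ b' s T JT); intros f Tf.
      pose proof (proj2 JT f Tf) as Tdf.
      (* The inverse image of [s] is a biproduct of two trivial objects, hence isomorphic to the
         trivial biproduct [s']. *)
      destruct (proj2 (exact_sub_additive (exactT _ Tdf)) _ _ (TX f Tf) (TY f Tf))
        as [s' Ts' Hs'].
      refine (replete_isomorphic RT Tdf _ Ts').
      apply (biproduct_isomorphic Hs').
      now apply (additive_functor_biproduct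
        (@abelian_inv_image _ _ _ A _ _ (arr f))).
  + intros X Y Z i p Hip [X' LX' IX] [Z' LZ' IZ].
    exists Y; [|exists (id Y), (id Y); split; apply comp_id_l].
    (* The ends are only given up to isomorphism, which local triviality in a fibre respects. *)
    assert (LX : locally_trivial_total (abelian_fib A) J Triv (fibre_val X)).
    { exact (locally_trivial_total_isomorphic trivT (isomorphic_sym IX) LX'). }
    assert (LZ : locally_trivial_total (abelian_fib A) J Triv (fibre_val Z)).
    { exact (locally_trivial_total_isomorphic trivT (isomorphic_sym IZ) LZ'). }
    destruct (@common_trivializing_covering _ _ _ _ _ _ trivT HM HC HL b' X Z
      LX LZ) as [T [JT [TX TZ]]].
    apply (@locally_trivial_of_J_l _ _ _ _ _ _ b' Y T JT); intros f Tf.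
    pose proof (proj2 JT f Tf) as Tdf.
    (* Flatness keeps the sequence short exact after inverse image, where both ends are trivial. *)
    pose proof (proj2 (flatT _ _ JT f Tf) _ _ _ i p Hip) as Hf.
    destruct (exact_sub_extensions (exactT _ Tdf) Hf) as [Y' TY' IY].
    * exists (inv_image (abelian_fib A) (arr f) X); [exact (TX f Tf)|].
      exists (id _), (id _); split; apply comp_id_l.
    * exists (inv_image (abelian_fib A) (arr f) Z); [exact (TZ f Tf)|].
      exists (id _), (id _); split; apply comp_id_l.
    * exact (replete_isomorphic RT Tdf (isomorphic_sym IY) TY').
Qed.
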